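(* There is an absolute constant $C_0>0$ such that for all $\theta\in(0,1)$, $w\in\mathbb{S}^2$ and $p,q\in\mathbb{R}^3$ with $p\neq q$, the map $p\mapsto u=\theta p'+(1-\theta)p$ (with $q,w,\theta$ held fixed, and $p'$ the post-collisional momentum in center-of-momentum coordinates defined in the context) satisfies $$\left|\det\left(\frac{\partial u}{\partial p}\right)\right|\le C_0\,(p^0)^{\frac12}(q^0)^{\frac32}.$$
   Context: The speed of light and the rest mass are normalized to $1$. For $p,q\in\mathbb{R}^3$ put $p^0=\sqrt{1+|p|^2}$, $q^0=\sqrt{1+|q|^2}$, $$g=g(p,q)=\sqrt{2(p^0q^0-p\cdot q-1)}\ge 0,\qquad s=s(p,q)=g^2+4=2(p^0q^0-p\cdot q+1),\qquad \gamma=\frac{p^0+q^0}{\sqrt{s}}.$$ One has the identity $\gamma-1=\frac{|p+q|^2}{\sqrt{s}\,(p^0+q^0+\sqrt{s})}$; accordingly, the quotient $\frac{\gamma-1}{|p+q|^2}$ is always read as $\frac{1}{\sqrt{s}(p^0+q^0+\sqrt{s})}$, also when $p+q=0$. For $w\in\mathbb{S}^2$ (the unit sphere of $\mathbb{R}^3$) the post-collisional momentum in center-of-momentum coordinates is $$p'=\frac{p+q}{2}+\frac{g}{2}\left(w+(\gamma-1)(p+q)\frac{(p+q)\cdot w}{|p+q|^2}\right).$$ Here $\frac{\partial u}{\partial p}=\left(\frac{\partial u_i}{\partial p_j}\right)_{1\le i,j\le 3}$ is the Jacobian matrix. *)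

(* Defs.v *)
From mathcomp Require Import all_boot all_order all_algebra.
From mathcomp Require Import all_classical all_reals all_analysis.
From mathcomp Require Import ring.
Set Implicit Arguments.
Unset Strict Implicit.
Unset Printing Implicit Defensive.
Import Order.TTheory GRing.Theory Num.Theory.
Import numFieldNormedType.Exports.
Local Open Scope ring_scope.

(* The library's norm `|v| on 'rV[R]_n is the max norm, so the Euclidean norm
   is defined separately. *)
Definition dotp (R : realType) (u v : 'rV[R]_3) : R := \sum_i u 0 i * v 0 i.

Definition enorm (R : realType) (v : 'rV[R]_3) : R := Num.sqrt (dotp v v).

Definition energy (R : realType) (p : 'rV[R]_3) : R :=
  Num.sqrt (1 + enorm p ^+ 2).

Definition relmom (R : realType) (p q : 'rV[R]_3) : R :=
  Num.sqrt (2 * (energy p * energy q - dotp p q - 1)).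

Definition cmenergy2 (R : realType) (p q : 'rV[R]_3) : R :=
  relmom p q ^+ 2 + 4.

Definition gammacm (R : realType) (p q : 'rV[R]_3) : R :=
  (energy p + energy q) / Num.sqrt (cmenergy2 p q).

(* The quotient (gamma - 1) / |p + q|^2, continued to p + q = 0;
   see gamma_quotE. *)
Definition gamma_quot (R : realType) (p q : 'rV[R]_3) : R :=
  (Num.sqrt (cmenergy2 p q)
     * (energy p + energy q + Num.sqrt (cmenergy2 p q)))^-1.

Definition postmom (R : realType) (p q w : 'rV[R]_3) : 'rV[R]_3 :=
  2^-1 *: (p + q)
  + (relmom p q / 2) *: (w + (gamma_quot p q * dotp (p + q) w) *: (p + q)).

Definition umap (R : realType) (theta : R) (q w p : 'rV[R]_3) : 'rV[R]_3 :=
  theta *: postmom p q w + (1 - theta) *: p.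

(* 'J acts on row vectors on the right, so ('J f p) i j is the i-th partial
   derivative of the j-th component; the transpose has the usual layout
   (d f_i / d p_j). *)
Definition jacmx (R : realType) (f : 'rV[R]_3 -> 'rV[R]_3) (p : 'rV[R]_3) :
  'M[R]_3 := ('J f p)^T.

Lemma enorm_sqr (R : realType) (v : 'rV[R]_3) : enorm v ^+ 2 = dotp v v.
Proof.
by rewrite sqr_sqrtr //; apply: sumr_ge0 => i _; rewrite -expr2 sqr_ge0.
Qed.

Lemma energy_sqr (R : realType) (p : 'rV[R]_3) :
  energy p ^+ 2 = 1 + dotp p p.
Proof. by rewrite sqr_sqrtr enorm_sqr // -enorm_sqr addr_ge0 ?sqr_ge0. Qed.

Lemma energy_gt0 (R : realType) (p : 'rV[R]_3) : 0 < energy p.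
Proof. by rewrite sqrtr_gt0 ltr_wpDr ?sqr_ge0. Qed.

Lemma energy_dotp (R : realType) (p q : 'rV[R]_3) :
  1 + dotp p q <= energy p * energy q.
Proof.
have E0 : 0 <= energy p * energy q by rewrite mulr_ge0 ?ltW ?energy_gt0.
apply: (le_trans (ler_norm _)).
rewrite -(ger0_norm E0) -ler_sqr ?nnegrE // !real_normK ?num_real // exprMn !energy_sqr.
rewrite /dotp !big_ord_recr !big_ord0 /=.
set p0 := p _ _; set p1 := p _ _; set p2 := p _ _.
set q0 := q _ _; set q1 := q _ _; set q2 := q _ _.
rewrite -subr_ge0.
have -> : (1 + (0 + p0 * p0 + p1 * p1 + p2 * p2))
    * (1 + (0 + q0 * q0 + q1 * q1 + q2 * q2))
    - (1 + (0 + p0 * q0 + p1 * q1 + p2 * q2)) ^+ 2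
  = (p0 - q0) ^+ 2 + (p1 - q1) ^+ 2 + (p2 - q2) ^+ 2
    + (p0 * q1 - p1 * q0) ^+ 2 + (p1 * q2 - p2 * q1) ^+ 2
    + (p2 * q0 - p0 * q2) ^+ 2 by ring.
by rewrite !addr_ge0 ?sqr_ge0.
Qed.

Lemma cmenergy2E (R : realType) (p q : 'rV[R]_3) :
  cmenergy2 p q = 2 * (energy p * energy q - dotp p q + 1).
Proof.
rewrite /cmenergy2 sqr_sqrtr; first by ring.
by rewrite mulr_ge0 // -addrA -opprD subr_ge0 addrC energy_dotp.
Qed.

Lemma gamma_quotE (R : realType) (p q : 'rV[R]_3) :
  gammacm p q - 1 = gamma_quot p q * enorm (p + q) ^+ 2.
Proof.
have s0 : 0 < cmenergy2 p q by rewrite ltr_wpDl ?sqr_ge0.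
have r0 : 0 < Num.sqrt (cmenergy2 p q) by rewrite sqrtr_gt0.
have e0 : 0 < energy p + energy q by rewrite addr_gt0 ?energy_gt0.
have -> : enorm (p + q) ^+ 2
    = (energy p + energy q) ^+ 2 - Num.sqrt (cmenergy2 p q) ^+ 2.
  rewrite (sqr_sqrtr (ltW s0)) cmenergy2E sqrrD !energy_sqr enorm_sqr.
  rewrite /dotp !big_ord_recr !big_ord0 /= !mxE; ring.
rewrite /gammacm /gamma_quot; field.
by rewrite (gt_eqF r0) gt_eqF // addr_gt0.
Qed.

(* Main.v *)
From HB Require Import structures.
Require Import Defs.
From mathcomp Require Import all_boot all_order all_algebra.
From mathcomp Require Import all_classical all_reals all_analysis.
From mathcomp Require Import ring lra.
Import Order.TTheory GRing.Theory Num.Theory.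
Import numFieldNormedType.Exports.
Local Open Scope ring_scope.
Set Implicit Arguments.
Unset Strict Implicit.
Unset Printing Implicit Defensive.

(* Write P = p + q, E = p^0 + q^0, r = sqrt s, a = g (gamma - 1) / |P|^2 and
   k = theta / 2. Then u is an affine function of p plus
   k (g w + a (P.w) P), so its Jacobian is the rank-two perturbation
     alpha I + k w (x) y + k P (x) z,   alpha = 1 - k + k a (P.w),
   with y = grad g and z = grad (a (P.w)), and the determinant is
     alpha ((alpha + k w.y) (alpha + k P.z) - k^2 (w.z) (P.y)).
   With rho = sqrt (q^0 / p^0), the estimates |y| <= rho, |P| <= E, a E <= 1
   and E |z| <= 2 + E rho / r suffice, together with E^2 <= s p^0 q^0, which
   gives E rho / r <= q^0. *)

(** A row vector stands for the differential through [dotp], so gradients are handled by vector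
    algebra. Differentiability is bundled in because ['d f p] means nothing without it. *)
Definition has_grad {R : realType} (f : 'rV[R]_3 -> R) (p a : 'rV[R]_3) :=
  differentiable f p /\ forall v, 'd f p v = dotp a v.

(** * Euclidean inner product and norm on row vectors *)

Section Dotp.
Context {R : realType}.
Implicit Types (u v w : 'rV[R]_3) (k : R).

Lemma dotpE u v : dotp u v = (u *m v^T) 0 0.
Proof. by rewrite mxE; apply: eq_bigr => i _; rewrite mxE. Qed.

Lemma dotpC u v : dotp u v = dotp v u.
Proof. by apply: eq_bigr => i _; rewrite mulrC. Qed.

Lemma dotpDl u v w : dotp (u + v) w = dotp u w + dotp v w.
Proof. by rewrite !dotpE mulmxDl mxE. Qed.

Lemma dotpZl k u w : dotp (k *: u) w = k * dotp u w.
Proof. by rewrite !dotpE -scalemxAl mxE. Qed.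

Lemma dotpDr u v w : dotp w (u + v) = dotp w u + dotp w v.
Proof. by rewrite dotpC dotpDl !(dotpC w). Qed.

Lemma dotpZr k u w : dotp w (k *: u) = k * dotp w u.
Proof. by rewrite dotpC dotpZl dotpC. Qed.

Definition dotp_lin := (dotpDl, dotpDr, dotpZl, dotpZr).

Lemma dotp0l w : dotp 0 w = 0.
Proof. by rewrite dotpE mul0mx mxE. Qed.

Lemma dotp_delta v j : dotp (delta_mx 0 j) v = v 0 j.
Proof. by rewrite dotpC dotpE trmx_delta -colE mxE. Qed.

(** Lagrange's identity: after squaring, the gap is the squared length of the cross product. *)
Lemma dotp_CauchySchwarz u v : `|dotp u v| <= enorm u * enorm v.
Proof.
have uv0 : 0 <= enorm u * enorm v by rewrite mulr_ge0 ?sqrtr_ge0.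
rewrite -(ger0_norm uv0) -ler_sqr ?nnegrE // !real_normK ?num_real //.
rewrite exprMn !enorm_sqr -subr_ge0 /dotp !big_ord_recr !big_ord0 /=.
set u0 := u _ _; set u1 := u _ _; set u2 := u _ _.
set v0 := v _ _; set v1 := v _ _; set v2 := v _ _.
rewrite (_ : _ - _ = (u0 * v1 - u1 * v0) ^+ 2 + (u1 * v2 - u2 * v1) ^+ 2
  + (u2 * v0 - u0 * v2) ^+ 2); last by ring.
by rewrite !addr_ge0 ?sqr_ge0.
Qed.

Lemma dotp_le u v (a b : R) : enorm u <= a -> enorm v <= b ->
  `|dotp u v| <= a * b.
Proof.
move=> ua vb; apply: le_trans (dotp_CauchySchwarz u v) _.
by rewrite ler_pM ?sqrtr_ge0.
Qed.

Lemma enormZ k u : enorm (k *: u) = `|k| * enorm u.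
Proof.
rewrite /enorm dotpZl dotpZr mulrA -expr2 sqrtrM ?sqr_ge0 //.
by rewrite sqrtr_sqr.
Qed.

Lemma enormD u v : enorm (u + v) <= enorm u + enorm v.
Proof.
rewrite -ler_sqr ?nnegrE ?addr_ge0 ?sqrtr_ge0 //.
rewrite sqrrD !enorm_sqr !dotp_lin (dotpC v u).
have := le_trans (ler_norm _) (dotp_CauchySchwarz u v); lra.
Qed.

End Dotp.

(** * Calculus of gradients, and Jacobians read off from them *)

Section Gradient.
Context {R : realType}.
Implicit Types (f g : 'rV[R]_3 -> R) (p a b : 'rV[R]_3).

(** Lets the rules below produce a raw gradient that is then identified with a closed form. *)
Lemma has_grad_eq {f p a b} : has_grad f p a -> a = b -> has_grad f p b.
Proof. by move=> fa <-. Qed.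

Lemma has_grad_cst (k : R) p : has_grad (fun=> k) p 0.
Proof.
split; first exact: differentiable_cst.
by move=> v; rewrite dotp0l diff_cst.
Qed.

Lemma has_grad_coord (j : 'I_3) p :
  has_grad (fun x => x 0 j) p (delta_mx 0 j).
Proof.
have cj : continuous (fun x : 'rV[R]_3 => x 0 j) by exact: coord_continuous.
pose l : 'rV[R]_3 -> R := fun x => x 0 j.
have ll : linear l by move=> k x y; rewrite /l !mxE.
pose L : {linear 'rV[R]_3 -> R} :=
  HB.pack l (GRing.isLinear.Build _ _ _ _ l ll).
split; first exact: (@linear_differentiable _ _ _ L).
by move=> v; rewrite dotp_delta (diff_lin (f := L)).
Qed.

Lemma has_gradD f g p a b : has_grad f p a -> has_grad g p b ->
  has_grad (fun x => f x + g x) p (a + b).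
Proof.
move=> [df fa] [dg gb]; split; first exact: differentiableD.
by move=> v; rewrite (diffD df dg) /= dotpDl -fa -gb.
Qed.

Lemma has_gradM f g p a b : has_grad f p a -> has_grad g p b ->
  has_grad (fun x => f x * g x) p (f p *: b + g p *: a).
Proof.
move=> [df fa] [dg gb]; split; first exact: differentiableM.
by move=> v; rewrite (diffM df dg) /= dotpDl !dotpZl -fa -gb.
Qed.

Lemma has_grad_comp (h : R -> R) (dh : R) f p a :
  is_derive (f p) 1 h dh -> has_grad f p a ->
  has_grad (h \o f) p (dh *: a).
Proof.
move=> [hd hE] [df fa].
have dh1 : differentiable h (f p) by apply/derivable1_diffP.
split; first exact: differentiable_comp.
move=> v; rewrite (diff_comp df dh1) /= dotpZl -fa.
by rewrite deriv1E //= derive1E hE mulrC.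
Qed.

Lemma has_grad_sqrt f p a : 0 < f p -> has_grad f p a ->
  has_grad (fun x => Num.sqrt (f x)) p ((2 * Num.sqrt (f p))^-1 *: a).
Proof. by move=> f0; apply: has_grad_comp; exact: is_derive1_sqrt. Qed.

Lemma has_gradV f p a : f p != 0 -> has_grad f p a ->
  has_grad (fun x => (f x)^-1) p (- (f p ^- 2) *: a).
Proof.
move=> f0; apply: has_grad_comp; split.
  exact: derivableV.
by rewrite deriveV // derive_id scaleNr [_ *: _]mulr1.
Qed.

Lemma has_grad_sum n (f : 'I_n -> 'rV[R]_3 -> R) p (a : 'I_n -> 'rV[R]_3) :
  (forall i, has_grad (f i) p (a i)) ->
  has_grad (fun x => \sum_i f i x) p (\sum_i a i).
Proof.
elim: n f a => [|n IH] f a fa.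
  rewrite big_ord0 (_ : (fun=> _) = fun=> 0); first exact: has_grad_cst.
  by apply/funext => x; rewrite big_ord0.
rewrite big_ord_recr (_ : (fun=> _) = (fun x =>
  \sum_(i < n) f (widen_ord (leqnSn n) i) x + f ord_max x)).
  by apply: has_gradD => //; apply: IH.
by apply/funext => x; rewrite big_ord_recr.
Qed.

Lemma has_grad_dotpr p b : has_grad (fun x => dotp x b) p b.
Proof.
have := has_grad_sum
  (fun i => has_gradM (has_grad_coord i p) (has_grad_cst (b 0 i) p)).
move/has_grad_eq; apply; rewrite [RHS]row_sum_delta.
by apply: eq_bigr => i _; rewrite scaler0 add0r.
Qed.

Lemma has_grad_dotpp p : has_grad (fun x => dotp x x) p (2 *: p).
Proof.
have := has_grad_sum
  (fun i => has_gradM (has_grad_coord i p) (has_grad_coord i p)).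
move/has_grad_eq; apply.
by rewrite big_split /= -row_sum_delta scaler_nat mulr2n.
Qed.

(** Since [jacmx] is transposed, its rows are the gradients of the components. Expanding [F] in the
    standard basis gives differentiability; the chain rule with a coordinate projection gives the
    entries. *)
Lemma jacmxE (F : 'rV[R]_3 -> 'rV[R]_3) p (M : 'M[R]_3) :
  (forall j, has_grad (fun x => F x 0 j) p (row j M)) ->
  differentiable F p /\ jacmx F p = M.
Proof.
move=> FM.
have FE : F = \sum_(j < 3) (fun x => F x 0 j *: (delta_mx 0 j : 'rV[R]_3)).
  apply/funext => x; rewrite fct_sumE; exact: row_sum_delta.
have dF : differentiable F p.
  rewrite FE; apply: differentiable_sum => j.
  by apply: differentiableZl; have [] := FM j.
split=> //; apply/matrixP => j i.
rewrite !mxE.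
have [_ /(_ (delta_mx 0 i))] := FM j.
rewrite dotpC dotp_delta mxE => <-.
have [dc cE] := has_grad_coord j (F p).
have := congr1 (fun h => h (delta_mx 0 i)) (diff_comp dF dc).
have H := etrans (cE ('d F p (delta_mx 0 i))) (dotp_delta _ _).
by move=> ->; exact: esym H.
Qed.

End Gradient.

(** * Determinants in dimension three *)

(** Entries are indexed by natural numbers so that the indices left by cofactor expansion compute to
    numerals. *)
Lemma det_mx33 {R : comPzRingType} (f : nat -> nat -> R) :
  \det (\matrix_(i < 3, j < 3) f i j) =
  f 0%N 0%N * (f 1%N 1%N * f 2%N 2%N - f 1%N 2%N * f 2%N 1%N)
  - f 0%N 1%N * (f 1%N 0%N * f 2%N 2%N - f 1%N 2%N * f 2%N 0%N)
  + f 0%N 2%N * (f 1%N 0%N * f 2%N 1%N - f 1%N 1%N * f 2%N 0%N).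
Proof.
rewrite (expand_det_row _ 0) !big_ord_recr big_ord0 /= /cofactor.
rewrite !(expand_det_row _ 0) !big_ord_recr !big_ord0 /= /cofactor.
rewrite !det_mx11 !mxE /=.
rewrite /bump /=; ring.
Qed.

(** An instance of Sylvester's determinant identity: k^(3-2) times the determinant of a 2 by 2
    matrix. Direct expansion also covers k = 0. *)
Lemma det_rank2_perturbation {R : realType} (k : R) (w y P z : 'rV[R]_3) :
  \det (k%:M + w^T *m y + P^T *m z) =
  k * ((k + dotp w y) * (k + dotp P z) - dotp w z * dotp P y).
Proof.
pose c (v : 'rV[R]_3) n := v 0 (inord n).
have cE (v : 'rV[R]_3) (i : 'I_3) : v 0 i = c v i by rewrite /c inord_val.
pose f i j := k *+ (i == j) + c w i * c y j + c P i * c z j.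
rewrite (_ : (_ + _) = \matrix_(i < 3, j < 3) f i j); last first.
  by apply/matrixP => i j; rewrite !mxE !big_ord1 !mxE !cE.
rewrite det_mx33 /f /dotp !big_ord_recr !big_ord0 /= !cE /=; ring.
Qed.

(** * Relations between the energies, g and s *)

Section Kinematics.
Context {R : realType}.
Implicit Types (p q w : 'rV[R]_3).

Lemma dotp_gt0 p : p != 0 -> 0 < dotp p p.
Proof.
move=> p0; rewrite lt_neqAle -{2}enorm_sqr sqr_ge0 andbT eq_sym.
apply: contra p0 => /eqP pp0; apply/eqP/rowP => i; rewrite mxE.
have /(_ i isT)/eqP := @psumr_eq0P _ _ xpredT (fun i => p 0 i * p 0 i)
  (fun i _ => sqr_ge0 (p 0 i)) pp0.
by rewrite mulf_eq0 orbb => /eqP.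
Qed.

Lemma enorm_le_energy p : enorm p <= energy p.
Proof.
by rewrite -ler_sqr ?nnegrE ?sqrtr_ge0 // energy_sqr enorm_sqr lerDr.
Qed.

Lemma energy_ge1 p : 1 <= energy p.
Proof.
rewrite -ler_sqr ?nnegrE ?sqrtr_ge0 // energy_sqr expr1n lerDl -enorm_sqr.
exact: sqr_ge0.
Qed.

Lemma cmenergy2_ge4 p q : 4 <= cmenergy2 p q.
Proof. by rewrite lerDr sqr_ge0. Qed.

Lemma cmenergy2_gt0 p q : 0 < cmenergy2 p q.
Proof. exact: lt_le_trans (cmenergy2_ge4 p q). Qed.

Lemma relmom_sqr p q :
  relmom p q ^+ 2 = 2 * (energy p * energy q - dotp p q - 1).
Proof. by have := cmenergy2E p q; rewrite /cmenergy2; lra. Qed.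

Lemma relmom_le_cm p q : relmom p q <= Num.sqrt (cmenergy2 p q).
Proof.
rewrite -ler_sqr ?nnegrE ?sqrtr_ge0 // [leRHS]sqr_sqrtr ?lerDl //.
exact: ltW (cmenergy2_gt0 p q).
Qed.

(* In fact g^2 E^2 >= s |p - q|^2: apply Cauchy-Schwarz to
   (p - q).(p + q) = (p^0 - q^0) E. *)
Lemma relmom_gt0 p q : p != q -> 0 < relmom p q.
Proof.
rewrite -subr_eq0 => /dotp_gt0 pq0.
rewrite lt_neqAle sqrtr_ge0 andbT eq_sym -sqrf_eq0 gt_eqF //.
have E0 : 0 < energy p + energy q by rewrite addr_gt0 ?energy_gt0.
suff : 0 < relmom p q ^+ 2 * (energy p + energy q) ^+ 2.
  by rewrite pmulr_lgt0 // exprn_gt0.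
have s0 : 0 < cmenergy2 p q * dotp (p - q) (p - q).
  by rewrite mulr_gt0 // cmenergy2_gt0.
apply: lt_le_trans s0 _.
have := dotp_CauchySchwarz (p - q) (p + q).
rewrite -ler_sqr ?nnegrE ?mulr_ge0 ?sqrtr_ge0 // real_normK ?num_real //.
rewrite exprMn !enorm_sqr cmenergy2E relmom_sqr.
have := energy_sqr p; have := energy_sqr q.
rewrite -[- q]scaleN1r !dotp_lin (dotpC q p).
set A := dotp p p; set B := dotp q q; set C := dotp p q.
set a := energy p; set b := energy q => bE aE.
have -> : A = a ^+ 2 - 1 by lra.
have -> : B = b ^+ 2 - 1 by lra.
(* As |p + q|^2 = E^2 - s and g^2 = |p - q|^2 - (p^0 - q^0)^2, the Cauchy-Schwarz gap is exactly g^2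
   E^2 - s |p - q|^2. *)
rewrite -subr_ge0 => H; rewrite -subr_ge0; apply: le_trans H _.
rewrite le_eqVlt; apply/orP; left; apply/eqP; ring.
Qed.

(* This is |q^0 p - p^0 q|^2 >= 0. *)
Lemma energy_le_cm p q :
  (energy p + energy q) ^+ 2 <= cmenergy2 p q * (energy p * energy q).
Proof.
have := sqr_ge0 (enorm (energy q *: p - energy p *: q)).
rewrite enorm_sqr -scaleNr !dotp_lin (dotpC q p) cmenergy2E.
have -> : dotp p p = energy p ^+ 2 - 1 by rewrite energy_sqr; ring.
have -> : dotp q q = energy q ^+ 2 - 1 by rewrite energy_sqr; ring.
rewrite -subr_ge0 subr0 => H; rewrite -subr_ge0; apply: le_trans H _.
rewrite le_eqVlt; apply/orP; left; apply/eqP; ring.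
Qed.

(** * Gradients of the collision quantities and the Jacobian of [umap] *)

Definition grad_relmom p q :=
  (relmom p q)^-1 *: ((energy q / energy p) *: p - q).

Lemma has_grad_energy p : has_grad (@energy R) p ((energy p)^-1 *: p).
Proof.
have e1 (x : 'rV[R]_3) : energy x = Num.sqrt (1 + dotp x x).
  by rewrite /energy enorm_sqr.
have p0 : 0 < 1 + dotp p p by rewrite -energy_sqr exprn_gt0 ?energy_gt0.
have := has_grad_sqrt p0 (has_gradD (has_grad_cst 1 p) (has_grad_dotpp p)).
rewrite -(_ : @energy R = fun x => Num.sqrt (1 + dotp x x)); last exact/funext.
move/has_grad_eq; apply; rewrite -e1 add0r scalerA; congr (_ *: _).
by field; rewrite gt_eqF ?energy_gt0.
Qed.

(** From g dg = d(p^0 q^0 - p.q). The condition [p != q] keeps the radicand positive, where the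
    square root is differentiable. *)
Lemma has_grad_relmom p q : p != q ->
  has_grad (fun x => relmom x q) p (grad_relmom p q).
Proof.
move=> pq; have g0 := relmom_gt0 pq.
have gg0 : 0 < 2 * (energy p * energy q - dotp p q - 1).
  by rewrite -relmom_sqr exprn_gt0.
have H := has_gradM (has_grad_cst 2 p) (has_gradD (has_gradD
  (has_gradM (has_grad_energy p) (has_grad_cst (energy q) p))
  (has_gradM (has_grad_cst (-1) p) (has_grad_dotpr p q)))
  (has_grad_cst (-1) p)).
have := @has_grad_sqrt _ _ _ _ _ H.
rewrite (_ : (fun x => _) = fun x => relmom x q); last first.
  by apply/funext => x; rewrite /relmom mulN1r.
rewrite mulN1r => /(_ gg0)/has_grad_eq; apply.
rewrite -/(relmom p q) /grad_relmom !scaler0 !addr0 add0r scaleN1r.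
by rewrite !scalerA -/(_ / _) invfM mulrAC mulVf ?mul1r ?pnatr_eq0.
Qed.

(** Follows from s = g^2 + 4. Keeping [grad_relmom] as a factor lets a single bound on grad g serve
    all later estimates. *)
Lemma has_grad_cm p q : p != q ->
  has_grad (fun x => Num.sqrt (cmenergy2 x q)) p
    ((relmom p q / Num.sqrt (cmenergy2 p q)) *: grad_relmom p q).
Proof.
move=> pq; have s0 := cmenergy2_gt0 p q.
have H := has_gradD (has_gradM (has_grad_relmom pq) (has_grad_relmom pq))
   (has_grad_cst 4 p).
have := @has_grad_sqrt _ (fun x => cmenergy2 x q) _ _ s0 H.
move/has_grad_eq; apply.
rewrite addr0 -scalerDl scalerA; congr (_ *: _).
by field; rewrite gt_eqF // sqrtr_gt0.
Qed.

(** The coefficient a of the overview. *)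
Definition postcoef p q := relmom p q * gamma_quot p q.

(** For k = 1 / (r (E + r)), dk = -k^2 ((E + 2 r) dr + (r / p^0) p). Inserting dr = (g / r) grad g
    into k grad g + g dk and collecting multiples of grad g and of p gives this form. *)
Definition grad_postcoef p q :=
  let g := relmom p q in let k := gamma_quot p q in
  let r := Num.sqrt (cmenergy2 p q) in
  (k - (g * k) ^+ 2 * ((energy p + energy q) / r + 2)) *: grad_relmom p q
  - (g * k ^+ 2 * r / energy p) *: p.

Lemma has_grad_postcoef p q : p != q ->
  has_grad (fun x => postcoef x q) p (grad_postcoef p q).
Proof.
move=> pq; have s0 := cmenergy2_gt0 p q.
have r0 : 0 < Num.sqrt (cmenergy2 p q) by rewrite sqrtr_gt0.
have e0 := energy_gt0 p; have f0 := energy_gt0 q.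
have D0 : 0 < Num.sqrt (cmenergy2 p q)
   * (energy p + energy q + Num.sqrt (cmenergy2 p q)).
  by rewrite mulr_gt0 // !addr_gt0.
have := has_gradM (has_grad_relmom pq) (@has_gradV _ (fun x =>
    Num.sqrt (cmenergy2 x q) * (energy x + energy q + Num.sqrt (cmenergy2 x q)))
    _ _ (lt0r_neq0 D0)
  (has_gradM (has_grad_cm pq) (has_gradD (has_gradD (has_grad_energy p)
     (has_grad_cst (energy q) p)) (has_grad_cm pq)))).
move/has_grad_eq; apply.
rewrite /grad_postcoef /gamma_quot addr0.
move: r0 D0; set r := Num.sqrt _; set y := grad_relmom p q; set g := relmom p q.
move=> r0 D0.
apply/rowP => i; rewrite !mxE; field.
by rewrite !gt_eqF ?relmom_gt0 // !addr_gt0.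
Qed.

(** An exact computation: q^0 / p^0 - |grad g|^2 = ((p^0 - q^0) / (g p^0))^2. Hence the factor 1 / g
    in the gradient causes no blow-up as p approaches q. *)
Lemma enorm_grad_relmom p q : p != q ->
  enorm (grad_relmom p q) <= Num.sqrt (energy q) / Num.sqrt (energy p).
Proof.
move=> pq; have g0 := relmom_gt0 pq.
have e0 := energy_gt0 p; have f0 := energy_gt0 q.
rewrite -ler_sqr ?nnegrE ?divr_ge0 ?sqrtr_ge0 //.
rewrite enorm_sqr exprMn exprVn (sqr_sqrtr (ltW e0)) (sqr_sqrtr (ltW f0)).
rewrite /grad_relmom -[- q]scaleN1r !dotp_lin (dotpC q p).
have -> : dotp p p = energy p ^+ 2 - 1 by rewrite energy_sqr; ring.
have -> : dotp q q = energy q ^+ 2 - 1 by rewrite energy_sqr; ring.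
have gg := relmom_sqr p q.
have -> : dotp p q = energy p * energy q - 1 - relmom p q ^+ 2 / 2 by lra.
move: g0 e0 f0; set g := relmom p q; set a := energy p; set b := energy q.
move=> g0 a0 b0.
rewrite -subr_ge0.
set L := (X in 0 <= X).
have -> : L = ((a - b) / (g * a)) ^+ 2.
  by rewrite /L; field; rewrite !gt_eqF.
exact: sqr_ge0.
Qed.

(** The vector z of the overview, by the product rule. *)
Definition grad_boost p q w : 'rV[R]_3 :=
  postcoef p q *: w + dotp (p + q) w *: grad_postcoef p q.

Lemma has_grad_boost p q w : p != q ->
  has_grad (fun x => postcoef x q * dotp (x + q) w) p (grad_boost p q w).
Proof.
move=> pq.
have := has_gradM (has_grad_postcoef pq)
  (has_gradD (has_grad_dotpr p w) (has_grad_cst (dotp q w) p)).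
rewrite addr0 -dotpDl.
rewrite (_ : (fun x => _) = (fun x => postcoef x q * dotp (x + q) w)) //.
by apply/funext => x; rewrite dotpDl.
Qed.

Lemma jacmx_umap (theta : R) p q w : p != q ->
  let k := theta / 2 in
  differentiable (umap theta q w) p /\
  jacmx (umap theta q w) p =
    (1 - k + k * (postcoef p q * dotp (p + q) w))%:M
    + w^T *m (k *: grad_relmom p q) + (p + q)^T *m (k *: grad_boost p q w).
Proof.
move=> pq k; apply: jacmxE => j.
have gP := has_gradD (has_grad_coord j p) (has_grad_cst (q 0 j) p).
(* Component j of u is grouped as k P_j + (1 - theta) p_j + k (g w_j + a (P.w) P_j). The first two
   terms contribute k + 1 - 2 k = 1 - k to the diagonal. *)
have := has_gradD (has_gradD (has_gradM (has_grad_cst k p) gP)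
    (has_gradM (has_grad_cst (1 - theta) p) (has_grad_coord j p)))
  (has_gradM (has_grad_cst k p)
    (has_gradD (has_gradM (has_grad_relmom pq) (has_grad_cst (w 0 j) p))
       (has_gradM (has_grad_boost w pq) gP))).
rewrite (_ : (fun x => _) = (fun x => umap theta q w x 0 j)); last first.
  by apply/funext => x; rewrite /umap /postmom /postcoef !mxE /k; field.
move/has_grad_eq; apply; apply/rowP => i.
move: (grad_relmom p q) (grad_boost p q w) => y z.
rewrite !mxE !big_ord1 !mxE -[ord0]/(0 : 'I_1) [i == j]eq_sym.
by case: (j == i); rewrite /k /=; field.
Qed.

(** * Size of a and of the gradients built from it *)

(** In a E = g E / (r (E + r)), compare g <= r and E <= E + r. *)
Lemma postcoef_bound p q :
  0 <= postcoef p q /\ postcoef p q * (energy p + energy q) <= 1.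
Proof.
have s0 := cmenergy2_gt0 p q.
have r0 : 0 < Num.sqrt (cmenergy2 p q) by rewrite sqrtr_gt0.
have e0 : 0 < energy p + energy q by rewrite addr_gt0 ?energy_gt0.
have g0 : 0 <= relmom p q by exact: sqrtr_ge0.
have gr := relmom_le_cm p q.
rewrite /postcoef /gamma_quot.
move: r0 e0 g0 gr; set r := Num.sqrt _; set E := _ + _; set g := relmom p q.
move=> r0 e0 g0 gr; split.
  by rewrite mulr_ge0 // invr_ge0 mulr_ge0 ?ltW // addr_gt0.
rewrite mulrAC ler_pdivrMr ?mul1r ?mulr_gt0 ?(addr_gt0 e0 r0) //.
by rewrite ler_pM ?(ltW e0) // lerDl ltW.
Qed.

Lemma enorm_momentum_sum p q : enorm (p + q) <= energy p + energy q.
Proof.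
by apply: le_trans (enormD p q) _; rewrite lerD ?enorm_le_energy.
Qed.

(** The coefficient of grad g is k minus a term in [0, 2 k], hence at most k in absolute value; the
    multiple of p accounts for E^-2. *)
Lemma enorm_grad_postcoef p q (rho : R) : enorm (grad_relmom p q) <= rho ->
  enorm (grad_postcoef p q) <=
  rho * gamma_quot p q + (energy p + energy q) ^- 2.
Proof.
move=> yrho.
have s0 := cmenergy2_gt0 p q.
have r0 : 0 < Num.sqrt (cmenergy2 p q) by rewrite sqrtr_gt0.
have p0 := energy_gt0 p; have q0 := energy_gt0 q.
have e0 : 0 < energy p + energy q by rewrite addr_gt0 ?energy_gt0.
have g0 : 0 <= relmom p q by exact: sqrtr_ge0.
have gr := relmom_le_cm p q.
have k0 : 0 < gamma_quot p q by rewrite invr_gt0 mulr_gt0 ?addr_gt0.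
have kE : gamma_quot p q * (Num.sqrt (cmenergy2 p q)
    * (energy p + energy q + Num.sqrt (cmenergy2 p q))) = 1.
  by rewrite mulVf // gt_eqF // mulr_gt0 ?addr_gt0.
have [a0 aE] := postcoef_bound p q.
have rho0 : 0 <= rho by apply: le_trans yrho; exact: sqrtr_ge0.
rewrite /grad_postcoef /=; apply: le_trans (enormD _ _) _.
rewrite -[X in _ + enorm X]scaleNr (enormZ _ (grad_relmom p q)) (enormZ _ p).
move: r0 e0 g0 gr k0 kE a0 aE; rewrite /postcoef.
set r := Num.sqrt _; set E := _ + _; set g := relmom p q.
set k := gamma_quot p q => r0 e0 g0 gr k0 kE a0 aE.
apply: lerD.
  rewrite mulrC ler_pM ?sqrtr_ge0 ?normr_ge0 //.
  have h0 : 0 <= (g * k) ^+ 2 * (E / r + 2).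
    by rewrite mulr_ge0 ?sqr_ge0 // addr_ge0 // divr_ge0 ?ltW.
  suff h2 : (g * k) ^+ 2 * (E / r + 2) <= 2 * k.
    by rewrite ler_norml; apply/andP; split; lra.
  (* By k r (E + r) = 1. It remains to compare g <= r and E / r + 2 <= 2 (E / r + 1). *)
  have -> : 2 * k = (r * k) ^+ 2 * (2 * (E / r + 1)).
    transitivity (2 * k * (k * (r * (E + r)))); first by rewrite kE mulr1.
    by field; exact: lt0r_neq0.
  have Er0 : 0 <= E / r by rewrite divr_ge0 ?ltW.
  rewrite ler_pM ?sqr_ge0 //; last by lra.
    by rewrite addr_ge0.
  by rewrite ler_sqr ?nnegrE ?(mulr_ge0 (ltW r0) (ltW k0)) // ler_pM2r.
have kr0 : 0 <= k * r by rewrite mulr_ge0 ?ltW.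
rewrite normrN ger0_norm; last first.
  by rewrite divr_ge0 ?(ltW p0) // mulr_ge0 ?(ltW r0) // mulr_ge0 ?sqr_ge0.
have -> : g * k ^+ 2 * r / energy p * enorm p
  = (g * k) * (k * r) * (enorm p / energy p) by ring.
rewrite -[leRHS]mulr1 ler_pM ?(mulr_ge0 a0 kr0) ?(divr_ge0 (sqrtr_ge0 _) (ltW p0)) //.
  (* Both g k = a and k r = 1 / (E + r) are at most 1 / E. *)
  rewrite expr2 invfM ler_pM //; rewrite -div1r ler_pdivlMr //.
  by rewrite -[leRHS]kE -mulrA ler_pM2l // ler_pM2l // lerDl ltW.
by rewrite ler_pdivrMr // mul1r enorm_le_energy.
Qed.

(** Since a E <= 1 and |P.w| <= E, the left side is at most 1 + E^2 |grad a| <= 2 + E^2 rho k. Then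
    k E <= 1 / r and E <= r sqrt(p^0 q^0) bound the last term by rho sqrt(p^0 q^0) = q^0. *)
Lemma enorm_grad_boost p q w : p != q -> enorm w = 1 ->
  (energy p + energy q) * enorm (grad_boost p q w) <= 2 + energy q.
Proof.
move=> pq w1.
have DE := enorm_grad_postcoef (enorm_grad_relmom pq).
have s0 := cmenergy2_gt0 p q.
have r0 : 0 < Num.sqrt (cmenergy2 p q) by rewrite sqrtr_gt0.
have p0 := energy_gt0 p; have q0 := energy_gt0 q.
have x0 : 0 < Num.sqrt (energy p) by rewrite sqrtr_gt0.
have y0 : 0 < Num.sqrt (energy q) by rewrite sqrtr_gt0.
have e0 : 0 < energy p + energy q by rewrite addr_gt0.
have k0 : 0 < gamma_quot p q by rewrite invr_gt0 mulr_gt0 ?addr_gt0.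
have [a0 aE] := postcoef_bound p q.
have kEr : gamma_quot p q * (energy p + energy q)
    * Num.sqrt (cmenergy2 p q) <= 1.
  rewrite /gamma_quot -mulrA mulrC ler_pdivrMr ?mulr_gt0 ?addr_gt0 //.
  by rewrite mul1r mulrC ler_pM2l // lerDl ltW.
have Er : energy p + energy q <=
    Num.sqrt (cmenergy2 p q) * (Num.sqrt (energy p) * Num.sqrt (energy q)).
  rewrite -(sqrtrM _ (ltW p0)) -(sqrtrM _ (ltW s0)) -[leLHS](ger0_norm (ltW e0)).
  by rewrite -sqrtr_sqr; apply/ler_wsqrtr/energy_le_cm.
have Pw : `|dotp (p + q) w| <= energy p + energy q.
  by rewrite -[leRHS]mulr1 dotp_le ?w1 // enorm_momentum_sum.
have Z : enorm (grad_boost p q w) <= postcoef p q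
    + (energy p + energy q) * enorm (grad_postcoef p q).
  apply: le_trans (enormD _ _) _; rewrite !enormZ w1 mulr1 ger0_norm //.
  by rewrite lerD2l ler_wpM2r ?sqrtr_ge0.
rewrite -(ler_pM2l e0) in Z; apply: le_trans Z _.
rewrite -[X in 2 + X](sqr_sqrtr (ltW q0)).
move: Er kEr k0 aE e0 r0 x0 y0 DE; set E := energy p + energy q.
set r := Num.sqrt (cmenergy2 p q); set x := Num.sqrt (energy p).
set y := Num.sqrt (energy q); set k := gamma_quot p q; set D := enorm _.
move=> Er kEr k0 aE e0 r0 x0 y0 DE.
have E2k : E ^+ 2 * (y / x * k) <= y ^+ 2.
  have -> : E ^+ 2 * (y / x * k) = E * (k * E * (y / x)) by ring.
  apply: (@le_trans _ _ (r * (x * y) * (k * E * (y / x)))).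
    rewrite ler_wpM2r //.
    exact: ltW (mulr_gt0 (mulr_gt0 k0 e0) (divr_gt0 y0 x0)).
  have -> : r * (x * y) * (k * E * (y / x)) = k * E * r * y ^+ 2.
    by field; exact: lt0r_neq0.
  by rewrite ler_piMl ?sqr_ge0.
have : E ^+ 2 * D <= E ^+ 2 * (y / x * k + E ^- 2) by rewrite ler_pM2l ?exprn_gt0.
rewrite [leRHS]mulrDr divff ?expf_neq0 ?lt0r_neq0 // => H.
have -> : E * (postcoef p q + E * D) = postcoef p q * E + E ^+ 2 * D by ring.
lra.
Qed.

End Kinematics.

(** * The bound on the determinant, assembled from the gradient estimates *)

Theorem corollary2p2 (R : realType) :
  exists C0 : R, 0 < C0 /\
    forall (theta : R) (w p q : 'rV[R]_3),
      0 < theta -> theta < 1 -> enorm w = 1 -> p != q ->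
      differentiable (umap theta q w) p /\
      `| \det (jacmx (umap theta q w) p) |
        <= C0 * (energy p `^ (1 / 2)) * (energy q `^ (3 / 2)).
Proof.
(* 11 = 3 + 1 + 5 + 2: the final bound expands to 3 + q^0 + 5 rho + 2 q^0 rho, and each of 1, q^0,
   rho, q^0 rho is at most (p^0)^(1/2) (q^0)^(3/2). *)
exists 11; split=> // theta w p q t0 t1 w1 pq.
have [du ->] := jacmx_umap theta w pq; split=> //.
set k := theta / 2.
have k0 : 0 <= k by rewrite divr_ge0 // ltW.
have k1 : k <= 1 by rewrite /k; lra.
have p0 := energy_gt0 p; have q0 := energy_gt0 q.
have -> : energy q `^ (3 / 2) = energy q * Num.sqrt (energy q).
  rewrite (_ : 3 / 2 = 1 + 2^-1); last by field.
  by rewrite powRD ?(gt_eqF q0) ?implybT // powRr1 ?powR12_sqrt // ltW.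
rewrite div1r powR12_sqrt ?(ltW p0) // det_rank2_perturbation !(dotpZr k).
have yy := sqr_sqrtr (ltW q0).
have x1 : 1 <= Num.sqrt (energy p) by rewrite -sqrtr1; apply/ler_wsqrtr/energy_ge1.
have y1 : 1 <= Num.sqrt (energy q) by rewrite -sqrtr1; apply/ler_wsqrtr/energy_ge1.
have rho0 : 0 <= Num.sqrt (energy q) / Num.sqrt (energy p).
  by rewrite divr_ge0 ?sqrtr_ge0.
have e0 : 0 < energy p + energy q by rewrite addr_gt0.
have [a0 aE] := postcoef_bound p q.
have aP : `|postcoef p q * dotp (p + q) w| <= 1.
  rewrite normrM ger0_norm //; apply: le_trans aE; rewrite ler_wpM2l //.
  by rewrite -[leRHS]mulr1 dotp_le ?w1 // enorm_momentum_sum.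
have yE := enorm_grad_relmom pq.
have PE := enorm_momentum_sum p q.
have w1' : enorm w <= 1 by rewrite w1.
(* The factor 1 / E here cancels |P| <= E, both in P.z and in the product (w.z)(P.y). *)
have zE : enorm (grad_boost p q w) <= (2 + energy q) / (energy p + energy q).
  by rewrite ler_pdivlMr // mulrC enorm_grad_boost.
have wy := dotp_le w1' yE.
have wz := dotp_le w1' zE.
have Py := dotp_le PE yE.
have Pz := dotp_le PE zE.
rewrite mul1r in wy; rewrite mulrC divfK ?gt_eqF // in Pz.
have wzPy := ler_pM (normr_ge0 _) (normr_ge0 _) wz Py.
rewrite -normrM mul1r mulrA divfK ?gt_eqF // in wzPy.
move: wy Pz wzPy aP rho0.
set A := dotp w (grad_relmom p q); set B := dotp (p + q) (grad_boost p q w).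
set D := dotp w _ * dotp _ _; set c := _ * dotp _ w; set rho := _ / _.
move=> hA hB hD hc rho0.
have hk u (m : R) : `|u| <= m -> `|k * u| <= m.
  move=> um; rewrite normrM (ger0_norm k0); apply: le_trans um.
  by rewrite ler_piMl.
(* A convex combination of 1 and c, with |c| <= 1. *)
have ha : `|1 - k + k * c| <= 1.
  by move: hc; rewrite !ler_norml => /andP[? ?]; apply/andP; split; nra.
have hkA := hk _ _ hA; have hkB := hk _ _ hB; have hkD := hk _ _ (hk _ _ hD).
have -> : k * dotp w (grad_boost p q w) * (k * dotp (p + q) (grad_relmom p q))
  = k * (k * D) by rewrite /D; ring.
rewrite normrM.
apply: (@le_trans _ _ (1 * ((1 + rho) * (3 + energy q) + (2 + energy q) * rho))).
  rewrite ler_pM //; apply: le_trans (ler_normB _ _) _; rewrite lerD //.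
  rewrite normrM ler_pM //; apply: le_trans (ler_normD _ _) _; first by rewrite lerD.
  by rewrite (_ : 3 + _ = 1 + (2 + energy q)) ?lerD //; ring.
rewrite mul1r.
have -> : rho = Num.sqrt (energy q) / Num.sqrt (energy p) by [].
(* In terms of x = sqrt(p^0) >= 1 and y = sqrt(q^0) >= 1 the target is 11 x y^3, and each monomial
   is compared with x y^3. *)
rewrite -[X in 3 + X]yy -[X in 2 + X]yy -[X in _ * (X * _)]yy.
move: x1 y1; set x := Num.sqrt (energy p); set y := Num.sqrt (energy q) => x1 y1.
have x0 : 0 < x by apply: lt_le_trans x1.
have y0 : 0 < y by apply: lt_le_trans y1.
have rho_y : y / x <= y by rewrite ler_pdivrMr // ler_peMr // ltW.
have yy1 : y <= y ^+ 2 by rewrite expr2 ler_peMr // ltW.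
have y2y3 : y ^+ 2 <= y ^+ 2 * y by rewrite ler_peMr // sqr_ge0.
have y3G : y ^+ 2 * y <= x * (y ^+ 2 * y).
  by rewrite ler_peMl // mulr_ge0 ?sqr_ge0 // ltW.
have y2rho : y ^+ 2 * (y / x) <= y ^+ 2 * y by rewrite ler_wpM2l ?sqr_ge0.
lra.
Qed.
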